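(* Let $k>0$ be a real number, put $m=2k>0$, and let $f(x)=\sin^2(2\pi k x)$ for $x\in[0,1]$. For every integer $P\ge 2$, the bias $B_P[f]=I_P[f]-I[f]$ of the $P$-point composite trapezoidal rule is given exactly by $$B_P[f] = -\frac{1}{2}\,\chi_P\!\left(\frac{m}{P}\right) + C(m),$$ where $\chi_P(y)=\frac1P\sum_{j=0}^{P-1}\cos(2\pi y j)$ and $C(m)=\frac{\sin(2\pi m)}{4\pi m}$.
   Context: The exact integral is $I[f]=\int_0^1 f(x)\,dx$. The $P$-point composite trapezoidal rule is defined by the average over the uniform grid $x_j=j/P$: $I_P[f]=\frac1P\sum_{j=0}^{P-1} f\!\left(\frac jP\right)$. The frequency $k$ is an arbitrary positive real number (not necessarily an integer); $f$ is regarded as extended periodically from $[0,1]$ to $\mathbb{R}$. The real resonance function is $\chi_P(y)=\frac1P\sum_{j=0}^{P-1}\cos(2\pi y j)$ for $y\in\mathbb{R}$. *)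

(* Defs.v *)
From Stdlib Require Import Reals.
From Coquelicot Require Import Coquelicot.
Open Scope R_scope.

(* The sums over 0 <= j <= P - 1 use [sum_f_R0 a n] = a 0 + ... + a n; with
   truncated subtraction, they are meaningful only for P >= 1. *)

Definition exact_integral (f : R -> R) : R := RInt f 0 1.

Definition trapezoidal_rule (P : nat) (f : R -> R) : R :=
  1 / INR P * sum_f_R0 (fun j => f (INR j / INR P)) (P - 1).

Definition bias (P : nat) (f : R -> R) : R :=
  trapezoidal_rule P f - exact_integral f.

Definition chi (P : nat) (y : R) : R :=
  1 / INR P * sum_f_R0 (fun j => cos (2 * PI * y * INR j)) (P - 1).

Definition C_term (m : R) : R := sin (2 * PI * m) / (4 * PI * m).

(* Main.v *)
Require Import Defs.
From Stdlib Require Import Reals Lra Lia.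
From Coquelicot Require Import Coquelicot.
Open Scope R_scope.

(** The double-angle formula ([sin_sqr_half_angle]) turns the integrand into the
    constant [1/2] minus half of the single cosine mode [cos (2 PI m x)].  The
    rule and the integral both send the constant to itself, so it cancels in the
    bias.  What is left is [-1/2] times the error on one mode: sampling the mode
    at [j / P] gives the resonance function at [m / P], and its exact mean over
    the unit interval is [sin (2 PI m) / (2 PI m)], that is [2 * C_term m]
    ([is_RInt_half_minus_half_cos]).  This mean survives as [C_term m] because
    the mode need not complete a whole number of half-periods on the interval. *)

Lemma sin_sqr_half_angle (k x : R) :
  sin (2 * PI * k * x) ^ 2 = 1 / 2 - 1 / 2 * cos (2 * PI * (2 * k) * x).
Proof.
  replace (2 * PI * (2 * k) * x) with (2 * (2 * PI * k * x)) by ring.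
  rewrite cos_2a_sin. field.
Qed.

Lemma is_RInt_half_minus_half_cos (m : R) : m <> 0 ->
  is_RInt (fun x => 1 / 2 - 1 / 2 * cos (2 * PI * m * x)) 0 1
    (1 / 2 - C_term m).
Proof.
  intros hm. pose proof PI_neq0 as hpi.
  set (F := fun x => x / 2 - sin (2 * PI * m * x) / (4 * PI * m)).
  replace (1 / 2 - C_term m) with (minus (F 1) (F 0)).
  - apply (is_RInt_derive F).
    + intros x _. unfold F. auto_derive; [exact I | field; split; assumption].
    + intros x _. apply (ex_derive_continuous (V := R_NormedModule)).
      auto_derive. exact I.
  - unfold F, C_term, minus, plus, opp; simpl.
    rewrite Rmult_0_r, Rmult_1_r, sin_0. field. split; assumption.
Qed.

Lemma sum_f_R0_half_minus_half (g : nat -> R) (n : nat) :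
  sum_f_R0 (fun j => 1 / 2 - 1 / 2 * g j) n
    = INR (S n) / 2 - 1 / 2 * sum_f_R0 g n.
Proof.
  induction n as [|n IH].
  - simpl. field.
  - rewrite !tech5, IH, (S_INR (S n)). field.
Qed.

Theorem theorem3p1 (k m : R) (hk : 0 < k) (hm : m = 2 * k)
  (f : R -> R)
  (hf : forall x : R, 0 <= x <= 1 -> f x = (sin (2 * PI * k * x)) ^ 2)
  (P : nat) (hP : (2 <= P)%nat) :
  bias P f = - (1 / 2) * chi P (m / INR P) + C_term m.
Proof.
  assert (hP0 : 0 < INR P) by (apply lt_0_INR; lia).
  assert (hf' : forall x, 0 <= x <= 1 ->
            f x = 1 / 2 - 1 / 2 * cos (2 * PI * m * x)).
  { intros x hx. rewrite (hf x hx), hm. apply sin_sqr_half_angle. }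
  assert (hint : exact_integral f = 1 / 2 - C_term m).
  { apply is_RInt_unique.
    apply is_RInt_ext with (fun x => 1 / 2 - 1 / 2 * cos (2 * PI * m * x)).
    - intros x hx. rewrite Rmin_left, Rmax_right in hx by lra.
      symmetry. apply hf'. lra.
    - apply is_RInt_half_minus_half_cos. lra. }
  assert (hsum : trapezoidal_rule P f = 1 / 2 - 1 / 2 * chi P (m / INR P)).
  { unfold trapezoidal_rule, chi.
    rewrite (sum_eq _ (fun j => 1 / 2 - 1 / 2 * cos (2 * PI * (m / INR P) * INR j))).
    - rewrite sum_f_R0_half_minus_half.
      replace (S (P - 1)) with P by lia.
      field. lra.
    - intros j hj.
      (* The nodes lie in [0, 1], where [f] is prescribed. *)
      rewrite hf'.
      + do 3 f_equal. field. lra.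
      + assert (hjP : INR j <= INR P) by (apply le_INR; lia).
        pose proof (pos_INR j) as hj0. split.
        * apply Rdiv_le_0_compat; assumption.
        * apply Rle_div_l; lra. }
  unfold bias. rewrite hsum, hint. ring.
Qed.
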